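(* Let $G=G_1^{t_1}\square G_2^{t_2}\square \cdots \square G_k^{t_k}$ be a connected graph decomposed into its Cartesian prime factors, where $G_1,\ldots,G_k$ are pairwise non-isomorphic connected prime graphs and $t_1,\ldots,t_k$ are positive integers. Then $$\theta(G)=\max\left\{\left(\theta(G_i^{t_i})-1\right)\cdot \frac{|G|}{|G_i^{t_i}|} \; : \; i=1,\ldots,k\right\}+1.$$
   Context: Graphs are finite and simple; $|H|$ denotes the number of vertices of $H$. A vertex coloring of a graph is distinguishing if the identity is the only automorphism preserving it. The distinguishing threshold $\theta(H)$ of a graph $H$ is the minimum number $t$ such that for every $k\geq t$, every vertex coloring of $H$ using $k$ colors is distinguishing. The Cartesian product $G\square H$ has vertex set $V(G)\times V(H)$, with $(g,h)\sim(g',h')$ iff either $g=g'$ and $hh'\in E(H)$, or $gg'\in E(G)$ and $h=h'$; $H^t$ denotes the $t$-th Cartesian power. A graph is prime if it is not isomorphic to a Cartesian product of two graphs both non-isomorphic to it. *)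

(* Defs.v *)
From HB Require Import structures.
From mathcomp Require Import all_boot.
From mathcomp Require Import fingroup perm.
From mathcomp Require Import boolp.

Set Implicit Arguments.
Unset Strict Implicit.
Unset Printing Implicit Defensive.

Record graph := Graph {
  vert : finType;
  adj : rel vert;
  adj_sym : symmetric adj;
  adj_irr : irreflexive adj }.

Definition iso (A B : graph) : Prop :=
  exists f : vert A -> vert B, bijective f /\ forall x y, adj (f x) (f y) = adj x y.

Definition connected (G : graph) : Prop :=
  0 < #|vert G| /\ forall x y : vert G, connect (@adj G) x y.

Definition cprod_rel (A B : graph) : rel (vert A * vert B) :=
  fun x y => ((x.1 == y.1) && adj x.2 y.2) || (adj x.1 y.1 && (x.2 == y.2)).
Arguments cprod_rel : clear implicits.

Lemma cprod_sym (A B : graph) : symmetric (cprod_rel A B).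
Proof.
move=> x y; rewrite /cprod_rel [x.1 == _]eq_sym [x.2 == _]eq_sym.
by rewrite [adj x.2 _]adj_sym [adj x.1 _]adj_sym.
Qed.

Lemma cprod_irr (A B : graph) : irreflexive (cprod_rel A B).
Proof. by move=> x; rewrite /cprod_rel !adj_irr andbF andFb. Qed.

Definition cprod (A B : graph) : graph :=
  @Graph (vert A * vert B)%type (cprod_rel A B) (@cprod_sym A B) (@cprod_irr A B).

Definition gpow_rel (H : graph) (t : nat) : rel {ffun 'I_t -> vert H} :=
  fun x y => [exists i, adj (x i) (y i) && [forall j, (j != i) ==> (x j == y j)]].
Arguments gpow_rel : clear implicits.

Lemma gpow_sym (H : graph) (t : nat) : symmetric (gpow_rel H t).
Proof.
have imp : forall x y, gpow_rel H t x y -> gpow_rel H t y x.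
  move=> x y /existsP [i /andP [a /forallP f]]; apply/existsP; exists i.
  rewrite adj_sym a /=; apply/forallP => j; apply/implyP => ji.
  by rewrite eq_sym (implyP (f j) ji).
by move=> x y; apply/idP/idP; apply: imp.
Qed.

Lemma gpow_irr (H : graph) (t : nat) : irreflexive (gpow_rel H t).
Proof.
move=> x; apply/negbTE/existsP => -[i /andP [a _]].
by rewrite adj_irr in a.
Qed.

Definition gpow (H : graph) (t : nat) : graph :=
  @Graph {ffun 'I_t -> vert H} (gpow_rel H t) (@gpow_sym H t) (@gpow_irr H t).

Definition K1 : graph :=
  @Graph unit (fun _ _ => false) (fun _ _ => erefl) (fun _ => erefl).

Definition cprod_list (gs : seq graph) : graph := foldr cprod K1 gs.

Definition prime_graph (G : graph) : Prop :=
  ~ exists A B : graph, iso G (cprod A B) /\ ~ iso A G /\ ~ iso B G.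

Definition is_aut (G : graph) (f : {perm vert G}) : Prop :=
  forall x y, adj (f x) (f y) = adj x y.

Definition distinguishing (G : graph) (k : nat) (c : vert G -> 'I_k) : Prop :=
  forall f : {perm vert G}, is_aut f -> (forall x, c (f x) = c x) ->
    forall x, f x = x.

Definition uses_all (G : graph) (k : nat) (c : vert G -> 'I_k) : Prop :=
  forall j : 'I_k, exists x, c x = j.

Definition thr_ok (G : graph) (t : nat) : Prop :=
  forall k, t <= k -> forall c : vert G -> 'I_k, uses_all c -> distinguishing c.

Lemma theta_ex (G : graph) : exists t, (0 < t) && `[< thr_ok G t >].
Proof.
exists #|vert G|.+1; apply/andP; split => //; apply/asboolP.
move=> k lt c surj; exfalso.
have h1 : #|'I_k| <= #|codom c|.
  apply: subset_leq_card; apply/subsetP => j _.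
  by have [x <-] := surj j; exact: codom_f.
have h2 : #|codom c| <= #|vert G|.
  by rewrite (leq_trans (card_size _)) // size_codom.
by move: (leq_trans h1 h2); rewrite card_ord leqNgt lt.
Qed.

Definition theta (G : graph) : nat := ex_minn (theta_ex G).

(* Main.v *)
Require Import Defs.
From mathcomp Require Import all_boot.
From mathcomp Require Import fingroup perm.
From mathcomp Require Import boolp.

Set Implicit Arguments.
Unset Strict Implicit.
Unset Printing Implicit Defensive.

(** A colouring with k colours fails to be distinguishing exactly when some nontrivial automorphism
    f preserves it, so theta - 1 is the largest number of colours of a colouring invariant under a
    nontrivial automorphism. Distances in a product add up over the coordinates; hence fibers, and
    their images under automorphisms, are closed under geodesics, and a set closed under geodesics
    is closed under exchanging coordinates. By primality the image of a fiber of the prime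
    factorization is then a fiber, of an isomorphic factor, so every automorphism of G acts
    separately on the coordinates H_i = G_i^(t_i).

    If f acts nontrivially on H_i, every colour of an f-invariant colouring occurs above a
    transversal R of the orbits in H_i, which bounds the number of colours by |R| |G| / |H_i|,
    and |R| < theta(H_i). Conversely an invariant colouring of H_i, paired with the remaining
    coordinates, is an invariant colouring of G. *)

(** * Distances in connected graphs *)

Section Distance.
Variables (G : graph) (cG : connected G).

Definition walk (n : nat) (x y : vert G) : Prop :=
  exists2 p, path (@adj G) x p & last x p = y /\ size p = n.

Lemma walk_ex x y : exists n, `[< walk n x y >].
Proof.
have /connectP [p pp e] := cG.2 x y.
by exists (size p); apply/asboolP; exists p.
Qed.

Definition dist x y : nat := ex_minn (walk_ex x y).

Lemma dist_walk x y : walk (dist x y) x y.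
Proof. by rewrite /dist; case: ex_minnP => n /asboolP. Qed.

Lemma dist_le n x y : walk n x y -> dist x y <= n.
Proof. by move=> w; rewrite /dist; case: ex_minnP => m _; apply; apply/asboolP. Qed.

Lemma distxx x : dist x x = 0.
Proof. by apply/eqP; rewrite -leqn0; apply: dist_le; exists [::]. Qed.

Lemma dist_adj x y : adj x y -> dist x y <= 1.
Proof. by move=> a; apply: dist_le; exists [:: y]; rewrite //= a. Qed.

Lemma dist_triangle y x z : dist x z <= dist x y + dist y z.
Proof.
have [p pp [<- <-]] := dist_walk x y; have [q qq [<- <-]] := dist_walk (last x p) z.
by apply: dist_le; exists (p ++ q); rewrite ?cat_path ?pp // last_cat size_cat.
Qed.

Lemma dist0 x y : dist x y = 0 -> x = y.
Proof. by move=> e; have := dist_walk x y; rewrite e => -[[|? ?] _ [<- //]]. Qed.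

Lemma dist_lipschitz (g : vert G -> nat) :
  (forall x y, adj x y -> g y <= g x + 1) -> forall x y, g y <= g x + dist x y.
Proof.
move=> lip x y; have [p pp [<- <-]] := dist_walk x y.
elim: p x pp => [|z p IH] x /=; first by rewrite addn0.
move=> /andP [/lip le /IH h]; apply: leq_trans h _.
by rewrite -add1n addnA leq_add2r.
Qed.

Lemma dist_hom (h : vert G -> vert G) x y :
  (forall u v, adj (h u) (h v) = adj u v) -> dist (h x) (h y) <= dist x y.
Proof.
move=> hh; have [p pp [<- <-]] := dist_walk x y.
apply: dist_le; exists (map h p); last by rewrite last_map size_map.
by rewrite path_map; apply: sub_path pp => u v /=; rewrite hh.
Qed.

Lemma is_autV (f : {perm vert G}) : is_aut f -> is_aut f^-1%g.
Proof. by move=> af x y; rewrite -[RHS]af !permKV || rewrite -af !permKV. Qed.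

Lemma dist_aut (f : {perm vert G}) x y : is_aut f -> dist (f x) (f y) = dist x y.
Proof.
move=> af; apply/eqP; rewrite eqn_leq dist_hom //=.
by have := dist_hom (f x) (f y) (is_autV af); rewrite !permK.
Qed.

End Distance.

(** * Product coordinates and closure under geodesics *)

(** Presents [G] as a product through its projections alone, so that the same [G] can carry both the
    coordinates in the powers and the finer ones in the prime factors. *)
Record coordinates (G : graph) (I : finType) (F : I -> graph)
    (pr : forall i, vert G -> vert (F i)) : Prop := {
  coord_inj : forall x y, (forall i, pr i x = pr i y) -> x = y;
  coord_surj : forall v : (forall i, vert (F i)), exists x, forall i, pr i x = v i;
  coord_adj : forall x y, adj x y <->
    exists i, adj (pr i x) (pr i y) /\ forall j, j != i -> pr j x = pr j y }.

Section Coordinates.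
Variables (G : graph) (I : finType) (F : I -> graph).
Variable (pr : forall i, vert G -> vert (F i)).
Hypothesis cpr : coordinates pr.

Lemma upd_ex x i (v : vert (F i)) :
  exists y, pr i y = v /\ forall j, j != i -> pr j y = pr j x.
Proof.
have [y hy] := coord_surj cpr (dfwith (fun j => pr j x) v).
exists y; split=> [|j ji]; rewrite hy ?dfwith_in //.
by rewrite dfwith_out // eq_sym.
Qed.

Definition upd x i (v : vert (F i)) : vert G := sval (cid (upd_ex x v)).

Lemma pr_upd x i (v : vert (F i)) : pr i (upd x v) = v.
Proof. by rewrite /upd; case: cid => y []. Qed.

Lemma pr_updN x i (v : vert (F i)) j : j != i -> pr j (upd x v) = pr j x.
Proof. by rewrite /upd; case: cid => y [e h]; apply: h. Qed.

Lemma upd_eq x i (v : vert (F i)) y :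
  pr i y = v -> (forall j, j != i -> pr j y = pr j x) -> y = upd x v.
Proof.
move=> e h; apply: (coord_inj cpr) => j.
by have [->|ji] := eqVneq j i; rewrite ?pr_upd // pr_updN // h.
Qed.

Lemma upd_id x i : upd x (pr i x) = x.
Proof. by apply/esym/upd_eq. Qed.

Lemma upd_upd x i (v w : vert (F i)) : upd (upd x v) w = upd x w.
Proof.
by apply: upd_eq => [|j ji]; rewrite ?pr_upd // !pr_updN.
Qed.

Lemma adj_agree_off i x y : (forall j, j != i -> pr j x = pr j y) ->
  adj x y = adj (pr i x) (pr i y).
Proof.
move=> h; apply/idP/idP => a; last by apply/(coord_adj cpr); exists i.
have [j [b _]] := (coord_adj cpr x y).1 a.
by have [<- //|ji] := eqVneq j i; move: b; rewrite h // adj_irr.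
Qed.

Definition fiber p a x := forall q, q != p -> pr q x = pr q a.

Hypotheses (cG : connected G) (cF : forall i, connected (F i)).

(** The sum of coordinate distances grows by at most one along an edge, so it is bounded by the
    distance; conversely, shortest paths in the factors can be traversed one coordinate after
    another. *)
Lemma dist_coord x y : dist cG x y = \sum_i dist (cF i) (pr i x) (pr i y).
Proof.
apply/eqP; rewrite eqn_leq; apply/andP; split; last first.
  have := @dist_lipschitz _ cG (fun z => \sum_i dist (cF i) (pr i x) (pr i z)).
  rewrite -[X in _ <= X]add0n => /(_ _ x y); rewrite [X in _ <= X + _]big1; last first.
    by move=> i _; rewrite distxx.
  apply=> u v uv; have [i [a h]] := (coord_adj cpr u v).1 uv.
  rewrite (bigD1 i) //= [X in _ <= X + _](bigD1 i) //= addnAC leq_add //.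
    by apply: leq_trans (dist_triangle _ (pr i u) _ _) _; rewrite leq_add2l dist_adj.
  by apply: leq_sum => j ji; rewrite h.
have upd_le z i v : dist cG z (upd z v) <= dist (cF i) (pr i z) v.
  have [p pp [e <-]] := dist_walk (cF i) (pr i z) v.
  elim: p z pp e => [|w p IH] z /=; first by move=> _ <-; rewrite upd_id distxx.
  case/andP=> a pp e; apply: leq_trans (dist_triangle _ (upd z w) _ _) _.
  rewrite -add1n leq_add //.
    apply: dist_adj; rewrite (@adj_agree_off i) ?pr_upd // => j ji.
    by rewrite pr_updN.
  by rewrite -(upd_upd z w v); apply: IH; rewrite pr_upd.
(* [s] lists the coordinates in which [z] may still differ from [y]. *)
have H : forall s : seq I, uniq s -> forall z, (forall i, i \notin s -> pr i z = pr i y) ->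
    dist cG z y <= \sum_(i <- s) dist (cF i) (pr i z) (pr i y).
  elim=> [|i s IH] /=.
    move=> _ z h; rewrite (_ : z = y) ?distxx //.
    by apply: (coord_inj cpr) => i; apply: h.
  case/andP=> is_ us z h; rewrite big_cons.
  apply: leq_trans (dist_triangle _ (upd z (pr i y)) _ _) _.
  apply: leq_add (upd_le _ _ _) _; apply: leq_trans (IH us _ _) _.
    move=> j js; have [->|ji] := eqVneq j i; first by rewrite pr_upd.
    by rewrite pr_updN // h // inE negb_or ji.
  rewrite big_seq [X in _ <= X]big_seq; apply: leq_sum => j js.
  by rewrite pr_updN //; apply: contraNneq is_ => <-.
by apply: H => [|i]; rewrite ?index_enum_uniq ?mem_index_enum.
Qed.

Definition interval_closed (S : vert G -> Prop) := forall x y w,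
  S x -> S y -> dist cG x w + dist cG w y = dist cG x y -> S w.

(** Each coordinate of the exchanged vertex comes from [x] or from [y], so by additivity of
    distances it lies on a geodesic between them. *)
Lemma interval_closed_upd S x y q : interval_closed S -> S x -> S y ->
  S (upd x (pr q y)).
Proof.
move=> cS Sx Sy; apply: (cS x y) => //.
rewrite !dist_coord -big_split /=; apply: eq_bigr => j _.
by have [->|jq] := eqVneq j q; rewrite ?pr_upd ?pr_updN // distxx ?addn0 ?add0n.
Qed.

Lemma interval_closed_fiber p a : interval_closed (fiber p a).
Proof.
move=> x y w fx fy; rewrite !dist_coord -big_split /= => e q qp.
have sub j : dist (cF j) (pr j x) (pr j y) <=
    dist (cF j) (pr j x) (pr j w) + dist (cF j) (pr j w) (pr j y).
  exact: dist_triangle.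
move/eqP: e; rewrite eq_sym (bigD1 q) //= [X in _ == X](bigD1 q) //= => /eqP e.
(* The coordinates other than [q] already account for the whole distance from [x] to [y], so nothing
   is left for a detour in coordinate [q]. *)
have le : \sum_(i | i != q) dist (cF i) (pr i x) (pr i y) <=
  \sum_(i | i != q) (dist (cF i) (pr i x) (pr i w) + dist (cF i) (pr i w) (pr i y)).
  by apply: leq_sum.
have e0 : dist (cF q) (pr q x) (pr q y) = 0 by rewrite (fx q qp) (fy q qp) distxx.
move: le; rewrite e0 add0n in e; rewrite e -[X in _ <= X]add0n leq_add2r leqn0 addn_eq0.
by case/andP=> /eqP /dist0 <- _; exact: fx.
Qed.

Lemma interval_closed_aut (f : {perm vert G}) S : is_aut f -> interval_closed S ->
  interval_closed (fun x => S (f x)).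
Proof. by move=> af cS x y w Sx Sy e; apply: (cS (f x) (f y)); rewrite ?dist_aut. Qed.

End Coordinates.

(** * Automorphisms and fibers of prime factors *)

Section Induced.
Variables (G : graph) (A : {set vert G}).

Definition induced_rel : rel {x | x \in A} := fun x y => adj (val x) (val y).
Lemma induced_sym : symmetric induced_rel.
Proof. by move=> x y; apply: adj_sym. Qed.
Lemma induced_irr : irreflexive induced_rel.
Proof. by move=> x; apply: adj_irr. Qed.
Definition induced : graph := Graph induced_sym induced_irr.

End Induced.

Lemma iso_card (A B : graph) : iso A B -> #|vert A| = #|vert B|.
Proof. by case=> f [/bij_eq_card]. Qed.

Section PrimeCoordinates.
Variables (G : graph) (I : finType) (F : I -> graph).
Variable (pr : forall i, vert G -> vert (F i)).
Hypotheses (cpr : coordinates pr) (cG : connected G).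
Hypotheses (cF : forall i, connected (F i)) (pF : forall i, prime_graph (F i)).

Local Notation upd := (upd cpr).
Local Notation fiber := (fiber pr).

Lemma fiber_upd p a (v : vert (F p)) : fiber p a (upd a v).
Proof. by move=> q qp; rewrite pr_updN. Qed.

Lemma fiberE p a x : fiber p a x -> x = upd a (pr p x).
Proof. by move=> h; apply: upd_eq. Qed.

(** Automorphisms preserve geodesics, hence the image of a fiber admits coordinate exchanges;
    membership in this image is expressed through [f^-1]. *)
Lemma fiber_closed (f : {perm vert G}) p a q x y : is_aut f ->
  fiber p a x -> fiber p a y -> fiber p a (f^-1%g (upd (f x) (pr q (f y)))).
Proof.
move=> af fx fy.
apply: (@interval_closed_upd _ _ _ _ cpr cG cF (fun z => fiber p a (f^-1%g z))).
- apply: interval_closed_aut; first exact: is_autV.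
  exact: interval_closed_fiber.
- by rewrite permK.
- by rewrite permK.
Qed.

(* The image of a fiber is closed under exchanging coordinates, so it splits as the product of
   its intersections [A] and [B] with a fiber in direction q and with a layer orthogonal to it;
   A is nontrivial, hence primality makes B a single vertex. *)
Lemma aut_fiber_sub (f : {perm vert G}) p a a' : is_aut f -> fiber p a a' -> a' <> a ->
  exists q, pr q (f a) <> pr q (f a') /\ forall x, fiber p a x -> fiber q (f a) (f x).
Proof.
move=> af fa' aa'.
have fa : fiber p a a by [].
have [q nq] : exists q, pr q (f a) <> pr q (f a').
  apply/not_existsP => h; apply: aa'; apply/esym/(@perm_inj _ f)/(coord_inj cpr) => q.
  by apply: contrapT; exact: h.
exists q; split=> //.
(* [S] is the image of the fiber under [f]. *)
have [S SP] : exists S : {set vert G}, forall z, z \in S <-> fiber p a (f^-1%g z).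
  exists [set z | [forall r, (r != p) ==> (pr r (f^-1%g z) == pr r a)]] => z.
  rewrite inE; split=> [/'forall_implyP h r rp|h]; first exact/eqP/h.
  by apply/'forall_implyP => r rp; apply/eqP/h.
have Sf x : fiber p a x -> f x \in S by move=> h; apply/SP; rewrite permK.
have Supd z w r : z \in S -> w \in S -> upd z (pr r w) \in S.
  move=> /SP z1 /SP w1; apply/SP.
  by have := fiber_closed r af z1 w1; rewrite !permKV.
pose b := f a.
have Sb : b \in S by exact: Sf.
pose A := [set z in S | [forall r, (r != q) ==> (pr r z == pr r b)]].
pose B := [set z in S | pr q z == pr q b].
have AP z : reflect (z \in S /\ fiber q b z) (z \in A).
  rewrite inE; apply: (iffP andP) => -[zS h]; split=> //.
    by move=> r rq; apply/eqP; apply: (implyP (forallP h r)).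
  by apply/forallP => r; apply/implyP => rq; rewrite h.
have BP z : reflect (z \in S /\ pr q z = pr q b) (z \in B).
  by rewrite inE; apply: (iffP andP) => -[zS /eqP].
have toA z : z \in S -> upd b (pr q z) \in A.
  by move=> zS; apply/AP; split; [exact: Supd | exact: fiber_upd].
have toB z : z \in S -> upd z (pr q b) \in B.
  by move=> zS; apply/BP; split; [exact: Supd | exact: pr_upd].
have Sv (v : vert (F p)) : f (upd a v) \in S by apply: Sf; exact: fiber_upd.
(* The image of a fiber vertex is split into its coordinate [q] and its remaining coordinates. *)
pose g (v : vert (F p)) : vert (cprod (induced A) (induced B)) :=
  (exist (fun z => z \in A) _ (toA _ (Sv v)), exist (fun z => z \in B) _ (toB _ (Sv v))).
have iso_g : iso (F p) (cprod (induced A) (induced B)).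
  have ginj : injective g.
    move=> v w [/= e1 e2].
    have {}e1 : pr q (f (upd a v)) = pr q (f (upd a w)).
      by move/(congr1 (pr q)): e1; rewrite !pr_upd.
    have : f (upd a v) = f (upd a w).
      apply: (coord_inj cpr) => r; have [->//|rq] := eqVneq r q.
      by move/(congr1 (pr r)): e2; rewrite !pr_updN.
    by move/perm_inj/(congr1 (pr p)); rewrite !pr_upd.
  have gsurj y : exists v, g v = y.
    case: y => -[s sA] [t tB]; have [sS sf] := AP _ sA; have [tS tq] := BP _ tB.
    pose z := upd t (pr q s).
    have zS : z \in S by exact: Supd.
    have ez : f (upd a (pr p (f^-1%g z))) = z.
      by rewrite -fiberE ?permKV //; apply/SP.
    exists (pr p (f^-1%g z)); congr pair; apply: val_inj; rewrite /= ez.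
      by rewrite /z pr_upd -fiberE.
    by rewrite /z upd_upd -tq upd_id.
  exists g; split.
    have [h hg] := choice gsurj; exists h => v //; exact/ginj.
  move=> v w /=; rewrite /cprod_rel /=.
  rewrite /induced_rel /= -!val_eqE /=.
  set x := f (upd a v); set y := f (upd a w).
  have -> : adj v w = adj x y.
    by rewrite /x /y af (adj_agree_off cpr (i := p)) ?pr_upd // => j jp; rewrite !pr_updN.
  have eqA : (upd b (pr q x) == upd b (pr q y)) = (pr q x == pr q y).
    apply/eqP/eqP => [|-> //].
    by move/(congr1 (pr q)); rewrite !pr_upd.
  have eqB : (upd x (pr q b) = upd y (pr q b)) <-> (forall j, j != q -> pr j x = pr j y).
    split=> [e j jq|e]; first by move/(congr1 (pr j)): e; rewrite !pr_updN.
    by apply: upd_eq => [|j jq]; rewrite ?pr_upd // pr_updN // e.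
  have adA : adj (upd b (pr q x)) (upd b (pr q y)) = adj (pr q x) (pr q y).
    by rewrite (adj_agree_off cpr (i := q)) ?pr_upd // => j jp; rewrite !pr_updN.
  rewrite eqA adA; apply/idP/idP.
    case/orP=> /andP [].
      move=> /eqP e /(coord_adj cpr) [r [ad h]]; apply/(coord_adj cpr); exists r.
      have rq : r != q by apply: contraTneq ad => ->; rewrite !pr_upd adj_irr.
      move: ad; rewrite !pr_updN // => ad; split=> // j jr.
      by have [-> //|jq] := eqVneq j q; have := h _ jr; rewrite !pr_updN.
    by move=> ad /eqP/eqB h; rewrite (adj_agree_off cpr h).
  move=> ad; have [r [adr h]] := (coord_adj cpr x y).1 ad.
  have [e|rq] := eqVneq r q.
    by move: e adr h => -> -> /eqB ->; rewrite eqxx orbT.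
  rewrite h 1?eq_sym // eqxx /= (adj_agree_off cpr (i := r)); last first.
    by move=> j jr; have [->|jq] := eqVneq j q; rewrite ?pr_upd // !pr_updN // h.
  by rewrite !pr_updN // adr.
(* Besides [b], the choice of [q] provides a second vertex of [A]. *)
have cardA : 1 < #|vert (induced A)|.
  rewrite /= card_sig; apply/card_gt1P; exists b, (upd b (pr q (f a'))).
  split; [by apply/AP | exact: toA (Sf _ fa') |].
  by apply/eqP => /(congr1 (pr q)); rewrite pr_upd.
have cardP : #|vert (F p)| = #|vert (induced A)| * #|vert (induced B)|.
  by rewrite (iso_card iso_g) card_prod.
(* If [b] is the only vertex of [B], the image varies only in coordinate [q]; otherwise both factors
   are smaller than [F p], against primality. *)
have [cB|cB] := leqP #|vert (induced B)| 1.
  move=> x fx.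
  have hB z : z \in B -> z = b.
    move=> zB; have bB : b \in B by apply/BP.
    by have := fintype_le1P cB (exist _ z zB) (exist _ b bB) => /(congr1 val).
  move=> r rq; have /hB /(congr1 (pr r)) := toB _ (Sf _ fx).
  by rewrite pr_updN.
case: (pF (i := p)); exists (induced A), (induced B); split=> //.
split=> /iso_card e; move: cardP; rewrite -e.
  by move/eqP; rewrite -{1}[#|vert (induced A)|]muln1 eqn_pmul2l ?(ltnW cardA) // ltn_eqF.
by move/eqP; rewrite -{1}[#|vert (induced B)|]mul1n eqn_pmul2r ?(ltnW cB) // ltn_eqF.
Qed.

(** The inverse automorphism must lead back into direction [p], because [a] and [a'] differ only
    there; so [f] carries the fiber onto a whole fiber. *)
Lemma aut_fiber_iso (f : {perm vert G}) p a a' : is_aut f -> fiber p a a' -> a' <> a ->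
  exists q, (forall x, fiber p a x -> fiber q (f a) (f x)) /\ iso (F p) (F q).
Proof.
move=> af fa' aa'; have [q [nq sub]] := aut_fiber_sub af fa' aa'.
have subV y : fiber q (f a) y -> fiber p a (f^-1%g y).
  have ff : f a' <> f a by move/perm_inj.
  have [p' [_ sub']] := aut_fiber_sub (is_autV af) (sub _ fa') ff.
  rewrite permK in sub'; suff -> : p = p' by exact: sub'.
  apply: contrapT => /eqP pp'; apply: aa'.
  rewrite [a'](fiberE fa'); have := sub' _ (sub _ fa'); rewrite permK => /(_ p pp') ->.
  exact: upd_id.
exists q; split=> //; pose g v := pr q (f (upd a (i := p) v)).
have fE v w : forall r, r != q -> pr r (f (upd a (i := p) v)) = pr r (f (upd a (i := p) w)).
  by move=> r rq; rewrite !(sub _ (fiber_upd (p := p) a _)).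
exists g; split.
  exists (fun w => pr p (f^-1%g (upd (f a) (i := q) w))) => v; rewrite /g.
    by rewrite -(fiberE (sub _ (fiber_upd _ _))) permK pr_upd.
  by rewrite -(fiberE (subV _ (fiber_upd _ _))) permKV pr_upd.
move=> v w; rewrite /g -(adj_agree_off cpr (fE v w)) af (adj_agree_off cpr (i := p)) ?pr_upd //.
by move=> j jp; rewrite !pr_updN.
Qed.

(** [c] groups the coordinates so that isomorphic factors share a class. Changing a coordinate
    outside class [d] alters the image at most in one coordinate of an isomorphic factor, hence
    outside [d]; such changes lead from [x] to [y]. *)
Lemma aut_agree (C : eqType) (c : I -> C) (f : {perm vert G}) d x y :
  (forall p q, iso (F p) (F q) -> c p = c q) -> is_aut f ->
  (forall p, c p = d -> pr p x = pr p y) ->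
  forall p, c p = d -> pr p (f x) = pr p (f y).
Proof.
move=> cP af exy p cp.
have step z q v : c q <> d -> pr p (f (upd z (i := q) v)) = pr p (f z).
  move=> cq; have [-> //|/eqP nz] := eqVneq (upd z v) z.
  have fz : fiber q z (upd z v) by exact: fiber_upd.
  have [r [/(_ _ fz) sub /cP cr]] := aut_fiber_iso af fz nz.
  by apply: sub; apply: contra_notN cq => /eqP e; rewrite cr -e.
have H (s : seq I) z : (forall q, c q = d -> pr q z = pr q y) ->
    (forall q, q \notin s -> pr q z = pr q y) -> pr p (f z) = pr p (f y).
  elim: s z => [|q s IH] z hd hs.
    by congr (pr p (f _)); apply: (coord_inj cpr) => q; apply: hs.
  have [cq|cq] := eqVneq (c q) d.
    apply: IH => // r rs; have [->|rq] := eqVneq r q; first exact: hd.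
    by apply: hs; rewrite inE negb_or rq.
  rewrite -(step z q (pr q y)); last exact/eqP.
  apply: IH => r; have [->|rq] := eqVneq r q; rewrite ?pr_upd ?pr_updN //.
    exact: hd.
  by move=> rs; apply: hs; rewrite inE negb_or rq.
by apply: (H (enum I)) => // q; rewrite mem_enum.
Qed.

End PrimeCoordinates.

(** * The threshold and invariant colorings *)

Lemma invariant_card_lt_theta (G : graph) (T : finType) (f : {perm vert G}) (c : vert G -> T) :
  is_aut f -> f <> 1%g -> (forall x, c (f x) = c x) -> #|codom c| < theta G.
Proof.
move=> af f1 cf; rewrite /theta; case: ex_minnP => t /andP [t0 /asboolP ok] _.
rewrite ltnNge; apply/negP => le; apply: f1; apply/permP => x; rewrite perm1.
(* Numbering only the colors that occur makes the coloring surjective. *)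
pose c' y : 'I_#|codom c| := enum_rank_in (codom_f c x) (c y).
apply: (ok _ le c') => // [j|y]; last by rewrite /c' cf.
have /codomP [y e] := enum_valP j.
by exists y; rewrite /c' -e enum_valK_in.
Qed.

(** By minimality [theta G - 1] fails as a threshold; [1 < theta G] keeps this candidate positive,
    as the definition of [theta] demands. *)
Lemma theta_pred_invariant (G : graph) : 1 < theta G ->
  exists k (f : {perm vert G}) (c : vert G -> 'I_k),
    [/\ theta G - 1 <= k, is_aut f, f <> 1%g, uses_all c & forall x, c (f x) = c x].
Proof.
rewrite /theta; case: ex_minnP => t /andP [t0 _] tmin t1; apply: contrapT => no.
have : t <= t - 1.
  apply: tmin; rewrite subn_gt0 t1 /=; apply/asboolP => k tk c cs f af cf x.
  apply: contrapT => fx; apply: no; exists k, f, c; split=> //.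
  by move=> e; apply: fx; rewrite e perm1.
by rewrite leqNgt ltn_subrL t0.
Qed.

Lemma theta_gt0 (G : graph) : 0 < theta G.
Proof. by rewrite /theta; case: ex_minnP => t /andP []. Qed.

(** * Bounds for the threshold of a product *)

Section ThetaProduct.
Variables (G : graph) (I : finType) (H : I -> graph).
Variable (h : forall i, vert G -> vert (H i)).
Hypothesis ch : coordinates h.

Local Notation upd := (upd ch).

Lemma card_coord_preim i (v0 : vert (H i)) (R : {set vert (H i)}) :
  #|[set x | h i x \in R]| = #|R| * (#|vert G| %/ #|vert (H i)|).
Proof.
(* Resetting coordinate [i] to [v0] forgets only that coordinate, so every fiber of [h i] is as
   large as [S]. *)
pose S := [set x | h i x == v0].
have E (Q : {set vert (H i)}) : #|[set x | h i x \in Q]| = #|Q| * #|S|.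
  rewrite -cardsX; pose g x := (h i x, upd x v0).
  have ginj : injective g.
    move=> x y [e1 e2]; apply: (coord_inj ch) => j; have [->//|ji] := eqVneq j i.
    by move/(congr1 (h j)): e2; rewrite !pr_updN.
  rewrite -(card_imset _ ginj); apply: eq_card => -[v x].
  rewrite in_setX !inE /=; apply/imsetP/andP => [[z]|[vQ /eqP xv]].
    by rewrite inE => zQ [-> ->]; rewrite pr_upd.
  exists (upd x v); rewrite ?inE ?pr_upd // /g pr_upd upd_upd -xv.
  by rewrite upd_id.
rewrite E; congr (_ * _); rewrite -[#|vert G|]cardsT -[#|vert (H i)|]cardsT.
have -> : [set: vert G] = [set x | h i x \in [set: vert (H i)]] by apply/setP => x; rewrite !inE.
by rewrite E mulKn //; apply/card_gt0P; exists v0; rewrite inE.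
Qed.

Lemma upd_aut i (f : {perm vert (H i)}) : is_aut f ->
  exists2 g : {perm vert G}, is_aut g & forall x, g x = upd x (f (h i x)).
Proof.
move=> af; pose g x := upd x (f (h i x)).
have gA j x y : adj (h j (g x)) (h j (g y)) = adj (h j x) (h j y).
  rewrite /g; have [ji|ji] := eqVneq j i; last by rewrite !pr_updN.
  by subst j; rewrite !pr_upd af.
have gE j x y : h j (g x) = h j (g y) <-> h j x = h j y.
  rewrite /g; have [ji|ji] := eqVneq j i; last by rewrite !pr_updN.
  by subst j; rewrite !pr_upd; split=> [/perm_inj|->].
have ginj : injective g.
  by move=> x y e; apply: (coord_inj ch) => j; apply/gE; rewrite e.
exists (perm ginj) => [x y|x]; last by rewrite permE.
rewrite !permE; apply/idP/idP => /(coord_adj ch) [j [a e]]; apply/(coord_adj ch);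
  by exists j; split=> [|l /e /gE //]; move: a; rewrite gA.
Qed.

Variable x0 : vert G.

Lemma theta_coord_le i : (theta (H i) - 1) * (#|vert G| %/ #|vert (H i)|) < theta G.
Proof.
have [t1|t1] := leqP (theta (H i)) 1.
  by move: t1; rewrite -subn_eq0 => /eqP ->; exact: theta_gt0.
have [k [f [c [le af f1 cs cf]]]] := theta_pred_invariant t1.
have [v0 fv0] : exists v, f v <> v.
  apply/not_existsP => no; apply: f1; apply/permP => v; rewrite perm1.
  by apply: contrapT => /no.
have [g ag gE] := upd_aut af.
(* The second component records exactly the coordinates other than [i], which the lift [g] of [f]
   fixes. *)
pose c' x := (c (h i x), upd x v0).
have lt : #|codom c'| < theta G.
  apply: (@invariant_card_lt_theta _ _ g c' ag) => [g1|x].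
    apply: fv0; have := gE (upd x0 v0); rewrite g1 perm1 pr_upd.
    by move/(congr1 (h i)); rewrite !pr_upd.
  by rewrite /c' gE pr_upd cf upd_upd.
apply: leq_trans _ lt; rewrite ltnS.
(* [S] represents the choices of the other coordinates; every pair of a color and a member of [S]
   occurs as a value of [c']. *)
pose S := [set x | h i x \in [set v0]].
have -> : #|vert G| %/ #|vert (H i)| = #|S| by rewrite card_coord_preim // cards1 mul1n.
apply: leq_trans (leq_mul le (leqnn _)) _.
have -> : k * #|S| = #|setX [set: 'I_k] S| by rewrite cardsX cardsT card_ord.
apply: subset_leq_card.
apply/subsetP => -[j x]; rewrite in_setX !inE /= => /eqP xv.
have [v <-] := cs j; apply/codomP; exists (upd x v).
by rewrite /c' pr_upd upd_upd -xv upd_id.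
Qed.

Hypothesis respects : forall (f : {perm vert G}), is_aut f ->
  forall i x y, h i x = h i y -> h i (f x) = h i (f y).

(** The image in coordinate [i] depends on that coordinate alone, so the remaining ones may be
    filled in from [x0]. *)
Lemma coord_aut (f : {perm vert G}) : is_aut f -> forall i,
  exists2 g : {perm vert (H i)}, is_aut g & forall x, h i (f x) = g (h i x).
Proof.
move=> af i; pose g v := h i (f (upd x0 (i := i) v)).
have gE x : h i (f x) = g (h i x) by apply: respects; rewrite ?pr_upd.
have ginj : injective g.
  move=> v w /(respects (is_autV af)); rewrite !permK => e.
  by rewrite -(pr_upd ch x0 v) e pr_upd.
have off v w : forall j, j != i -> h j (upd x0 (i := i) v) = h j (upd x0 (i := i) w).
  by move=> j ji; rewrite !pr_updN.
exists (perm ginj) => [v w|x]; rewrite !permE //.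
rewrite /g -(@adj_agree_off _ _ _ _ ch); last by move=> j /(off v w); exact: respects.
by rewrite af (adj_agree_off ch (off v w)) !pr_upd.
Qed.

Lemma theta_le_coord : theta G <=
  (\max_i ((theta (H i) - 1) * (#|vert G| %/ #|vert (H i)|))).+1.
Proof.
have [t1|t1] := leqP (theta G) 1; first exact: leq_trans t1 _.
have [k [f [c [le af f1 cs cf]]]] := theta_pred_invariant t1.
have [i [v gv]] : exists i x, h i (f x) <> h i x.
  apply: contrapT => no; apply: f1; apply/permP => x; rewrite perm1.
  apply: (coord_inj ch) => i; apply: contrapT => n.
  by apply: no; exists i, x.
have [g ag gE] := coord_aut af i.
have gsym : connect_sym (frel g) := fconnect_sym (@perm_inj _ g).
apply: leq_trans (_ : k.+1 <= _); first by rewrite leq_subLR add1n in le.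
rewrite ltnS; apply: leq_trans (leq_bigmax i).
(* [R] contains one vertex from each orbit of [g]. *)
pose R := [set w | froot g w == w].
have kR : k <= #|[set x | h i x \in R]|.
  rewrite -[X in X <= _]card_ord -cardsT; apply: leq_trans (leq_imset_card c _).
  apply: subset_leq_card; apply/subsetP => j _; have [x <-] := cs j.
  have hf n : h i (iter n f x) = iter n g (h i x) by elim: n => //= n IH; rewrite gE IH.
  have cfn n : c (iter n f x) = c x by elim: n => //= n IH; rewrite cf.
  have fc : fconnect g (h i x) (froot g (h i x)) by exact: connect_root.
  (* Iterating [f] keeps the color while coordinate [i] runs through its orbit until it meets
     [R]. *)
  apply/imsetP; exists (iter (findex g (h i x) (froot g (h i x))) f x); last by rewrite cfn.
  by rewrite !inE hf iter_findex // root_root.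
apply: leq_trans kR _; rewrite (card_coord_preim (h i v)).
apply: leq_mul => //; rewrite -ltnS subn1 prednK ?theta_gt0 //.
(* [froot g] is itself a [g]-invariant coloring, and its colors include all of [R]. *)
apply: leq_ltn_trans (@invariant_card_lt_theta _ _ g (froot g) ag _ _).
- apply: subset_leq_card; apply/subsetP => w; rewrite inE => /eqP <-; exact: codom_f.
- by move=> g1; apply: gv; rewrite gE g1 perm1.
move=> w; apply/eqP; rewrite root_connect // gsym; exact: fconnect1.
Qed.

End ThetaProduct.

(** * Coordinates for iterated products and powers *)

Lemma iso_coordinates (G G' : graph) (I : finType) (F : I -> graph)
    (pr : forall i, vert G' -> vert (F i)) (f : vert G -> vert G') :
  bijective f -> (forall x y, adj (f x) (f y) = adj x y) -> coordinates pr ->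
  coordinates (fun i x => pr i (f x)).
Proof.
move=> bf af cp; split.
- by move=> x y e; apply: (bij_inj bf); apply: (coord_inj cp).
- move=> v; have [y hy] := coord_surj cp v; have [g _ gK] := bf.
  by exists (g y) => i; rewrite gK.
by move=> x y; rewrite -af; exact: coord_adj.
Qed.

(* The projections outside [s] are junk values, which keeps the induction on [s] over one index type. *)
Lemma cprod_list_coordinates_in (I : finType) (H : I -> graph) (s : seq I) :
  uniq s -> (forall i, vert (H i)) ->
  exists pr : forall i, vert (cprod_list [seq H i | i <- s]) -> vert (H i),
  [/\ forall x y, (forall i, i \in s -> pr i x = pr i y) -> x = y,
      forall v : (forall i, vert (H i)), exists x, forall i, i \in s -> pr i x = v i &
      forall x y, adj x y <-> exists2 i, i \in s & adj (pr i x) (pr i y) /\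
        forall j, j \in s -> j != i -> pr j x = pr j y].
Proof.
move=> us v0; elim: s us => [_|i s IH /andP [is_ us]] /=.
  exists (fun i _ => v0 i); split=> [[] [] //|v|x y]; first by exists tt.
  by split=> [|[]].
have [pr [inj surj ad]] := IH us.
pose q j (x : vert (H i) * vert (cprod_list [seq H i | i <- s])) : vert (H j) :=
  dfwith (fun l => pr l x.2) x.1 j.
have qi x : q i x = x.1 by rewrite /q dfwith_in.
have qN j x : j \in s -> q j x = pr j x.2.
  by move=> js; rewrite /q dfwith_out //; apply: contraNneq is_ => ->.
exists q; split.
- move=> [x1 x2] [y1 y2] e; congr pair.
    by have := e i (mem_head _ _); rewrite !qi.
  by apply: inj => j js; have := e j; rewrite !qN // => ->; rewrite // inE js orbT.
- move=> v; have [x hx] := surj v; exists (v i, x) => j; rewrite inE.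
  by have [->|_ /= js] := eqVneq j i; rewrite ?qi // qN // hx.
move=> x y; rewrite /= /cprod_rel; split.
  case/orP=> /andP [].
    move=> /eqP e /ad [j js [a o]]; exists j; first by rewrite inE js orbT.
    rewrite !qN //; split=> // l; rewrite inE.
    by have [->|_ /= ls] := eqVneq l i; rewrite ?qi // => lj; rewrite !qN // o.
  move=> a /eqP e; exists i; rewrite ?mem_head // !qi; split=> // l.
  by rewrite inE => /orP [/eqP ->|ls _]; rewrite ?eqxx // !qN // e.
case=> j; rewrite inE; have [->|ji /= js] := eqVneq j i.
  rewrite !qi => _ [a o]; rewrite a /=; apply/orP; right; apply/eqP/inj => l ls.
  by rewrite -!qN // o // ?inE ?ls ?orbT //; apply: contraNneq is_ => <-.
rewrite !qN // => -[a o]; apply/orP; left; apply/andP; split.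
  by rewrite -!qi o ?mem_head // eq_sym.
apply/ad; exists j => //; split=> // l ls lj.
by rewrite -!qN // o // inE ls orbT.
Qed.

Lemma cprod_list_coordinates (I : finType) (H : I -> graph) : (forall i, vert (H i)) ->
  exists pr : forall i, vert (cprod_list [seq H i | i <- enum I]) -> vert (H i), coordinates pr.
Proof.
move=> v0; have [pr [inj surj ad]] := cprod_list_coordinates_in (enum_uniq I) v0.
exists pr; split.
- by move=> x y e; apply: inj => i _; apply: e.
- by move=> v; have [x hx] := surj v; exists x => i; rewrite hx // mem_enum.
move=> x y; rewrite ad; split=> [[i _ [a o]]|[i [a o]]]; exists i;
  by rewrite ?mem_enum //; split=> // j *; rewrite o // mem_enum.
Qed.

(** Refines coordinates in powers to coordinates in single copies of the [F i]; primality is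
    available only at this finer level. *)
Lemma gpow_coordinates (G : graph) (I : finType) (F : I -> graph) (t : I -> nat)
    (h : forall i, vert G -> vert (gpow (F i) (t i))) : coordinates h ->
  coordinates (fun (p : {i : I & 'I_(t i)}) x => h (tag p) x (tagged p)).
Proof.
move=> ch; split.
- move=> x y e; apply: (coord_inj ch) => i; apply/ffunP => a.
  exact: (e (Tagged (fun i => 'I_(t i)) a)).
- move=> v; have [x hx] := coord_surj ch
    (fun i => [ffun a => v (Tagged (fun i => 'I_(t i)) a)] : vert (gpow (F i) (t i))).
  by exists x => -[i a] /=; rewrite hx ffunE.
move=> x y; rewrite (coord_adj ch); split.
  case=> i [/existsP [a /andP [ad /forallP o]] o'].
  exists (Tagged (fun i => 'I_(t i)) a); split=> // -[j b] /= ne.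
  have [ji|ji] := eqVneq j i; last by rewrite o'.
  subst j; apply/eqP; apply: (implyP (o b)).
  by apply: contraNneq ne => ->.
case=> -[i a] /= [ad o]; exists i; split.
  apply/existsP; exists a; rewrite ad /=; apply/forallP => b; apply/implyP => ba.
  apply/eqP/(o (Tagged (fun i => 'I_(t i)) b)).
  by rewrite -tag_eqE /tag_eq eqxx tagged_asE.
move=> j ji; apply/ffunP => b; apply: (o (Tagged (fun i => 'I_(t i)) b)).
by apply: contraNneq ji => /(congr1 tag) /= ->.
Qed.

Theorem theorem4p3 (G : graph) (k : nat) (Gs : 'I_k -> graph) (ts : 'I_k -> nat) :
  connected G ->
  (forall i, connected (Gs i)) ->
  (forall i, prime_graph (Gs i)) ->
  (forall i j, i != j -> ~ iso (Gs i) (Gs j)) ->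
  (forall i, 0 < ts i) ->
  iso G (cprod_list [seq gpow (Gs i) (ts i) | i <- enum 'I_k]) ->
  theta G =
    (\max_(i < k) ((theta (gpow (Gs i) (ts i)) - 1) *
                   (#|vert G| %/ #|vert (gpow (Gs i) (ts i))|))).+1.
Proof.
move=> cG cGs pGs nGs _ [f [bf af]].
have /card_gt0P [x0 _] := cG.1.
have v0 i : vert (gpow (Gs i) (ts i)).
  by apply: finfun => _; have /card_gt0P/cid [] := (cGs i).1.
have [pr cpr] := cprod_list_coordinates v0.
have ch := iso_coordinates bf af cpr.
have cq := gpow_coordinates ch.
apply/eqP; rewrite eqn_leq; apply/andP; split; last first.
  have lt i : (theta (gpow (Gs i) (ts i)) - 1) * (#|vert G| %/ #|vert (gpow (Gs i) (ts i))|)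
      < theta G by exact: (theta_coord_le ch x0).
  rewrite -[theta G]prednK ?theta_gt0 // ltnS; apply/bigmax_leqP => i _.
  by rewrite -ltnS prednK ?theta_gt0.
(* Agreement in the power [i] means agreement in all prime coordinates tagged [i]. As the [Gs i] are
   pairwise non-isomorphic, tags can serve as the classes in [aut_agree]. *)
apply: (theta_le_coord ch x0) => g ag i x y e; apply/ffunP => a.
have cP (p q : {i & 'I_(ts i)}) : iso (Gs (tag p)) (Gs (tag q)) -> tag p = tag q.
  by move=> pq; apply: contrapT => /eqP /nGs.
apply: (aut_agree cq cG (fun p => cGs (tag p)) (fun p => pGs (tag p)) cP ag (d := i)
  (x := x) (y := y) _ (p := Tagged (fun i => 'I_(ts i)) a)) => // -[j b] /= ji.
by subst j; rewrite e.
Qed.
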